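(* Let $(X,\mathcal{T},E)$ and $(Y,\mathcal{S},E')$ be soft topological spaces and let $f:(X,\mathcal{T},E)\to(Y,\mathcal{S},E')$ be a soft function. The following are equivalent: (1) $f$ is soft $sw$-open; (2) $f(\mathrm{Int}(G_E))\sqsubseteq\mathrm{Int}_{sw}(f(G_E))$ for each soft set $G_E$ over $X$; (3) $f^{-1}(\mathrm{Cl}_{sw}(H_{E'}))\sqsubseteq\mathrm{Cl}(f^{-1}(H_{E'}))$ for each soft set $H_{E'}$ over $Y$.
   Context: A soft set $F_E$ over a set $X$ with parameter set $E$ is a map $F:E\to\mathcal{P}(X)$. The null soft set $\Phi_E$ has all values $\emptyset$; the absolute soft set $X_E$ has all values $X$. Inclusion $\sqsubseteq$, union $\sqcup$, intersection $\sqcap$ and complement are taken parameterwise. A soft topology $\mathcal{T}$ on $X$ is a family of soft sets over $X$ (with parameters $E$) containing $\Phi_E$ and $X_E$ and closed under finite intersections and arbitrary unions; $(X,\mathcal{T},E)$ is a soft topological space, members of $\mathcal{T}$ are soft open and their complements are soft closed. $\mathrm{Int}(F_E)$ is the largest soft open set contained in $F_E$ and $\mathrm{Cl}(F_E)$ the smallest soft closed set containing $F_E$. A soft function $f$ from $X$ (parameters $E$) to $Y$ (parameters $E'$) is given by maps $u:X\to Y$ and $p:E\to E'$; $f(F_E)(e')=\bigcup_{e\in p^{-1}(e')}u(F(e))$ for $e'\in E'$, and $f^{-1}(G_{E'})(e)=u^{-1}(G(p(e)))$ for $e\in E$. In any soft topological space, a soft set is soft $sw$-open (soft somewhat open) if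 it is null or its soft interior is non-null; complements of soft $sw$-open sets are soft $sw$-closed. $\mathrm{Cl}_{sw}(G)$ is the soft intersection of all soft $sw$-closed sets containing $G$; $\mathrm{Int}_{sw}(G)$ is the soft union of all soft $sw$-open sets contained in $G$. The soft function $f$ is soft $sw$-open if $f(U_E)$ is soft $sw$-open over $Y$ for each soft open set $U_E$ over $X$. *)

(* Defs.v *)
From mathcomp Require Import all_boot.
From mathcomp Require Import boolp classical_sets.

Set Implicit Arguments.
Unset Strict Implicit.
Unset Printing Implicit Defensive.

Local Open Scope classical_set_scope.

Definition soft_set (X E : Type) := E -> set X.

Section SoftSets.
Variables X E : Type.
Implicit Types (F G : soft_set X E) (A : set (soft_set X E)).

Definition soft_null : soft_set X E := fun=> set0.

Definition soft_abs : soft_set X E := fun=> setT.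

Definition soft_subset F G := forall e, F e `<=` G e.

Definition soft_setI F G : soft_set X E := fun e => F e `&` G e.

Definition soft_setC F : soft_set X E := fun e => ~` F e.

Definition soft_bigcup A : soft_set X E := fun e => \bigcup_(F in A) F e.

Definition soft_bigcap A : soft_set X E := fun e => \bigcap_(F in A) F e.

End SoftSets.

Arguments soft_null {X E}.
Arguments soft_abs {X E}.

Notation "F [<=] G" := (soft_subset F G)
  (at level 70, no associativity) : classical_set_scope.

Record soft_topology (X E : Type) := SoftTopology {
  soft_open : set (soft_set X E);
  soft_open_null : soft_open soft_null;
  soft_open_abs : soft_open soft_abs;
  soft_openI : forall F G,
    soft_open F -> soft_open G -> soft_open (soft_setI F G);
  soft_open_bigcup : forall A : set (soft_set X E),
    A `<=` soft_open -> soft_open (soft_bigcup A)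
}.

Section SoftTopology.
Variables (X E : Type) (T : soft_topology X E).
Implicit Types F G : soft_set X E.

Definition soft_closed F := soft_open T (soft_setC F).

Definition soft_int F : soft_set X E :=
  soft_bigcup [set U | soft_open T U /\ U [<=] F].

Definition soft_cl F : soft_set X E :=
  soft_bigcap [set C | soft_closed C /\ F [<=] C].

Definition soft_sw_open F := F = soft_null \/ soft_int F <> soft_null.

Definition soft_sw_closed F := soft_sw_open (soft_setC F).

Definition soft_sw_cl F : soft_set X E :=
  soft_bigcap [set C | soft_sw_closed C /\ F [<=] C].

Definition soft_sw_int F : soft_set X E :=
  soft_bigcup [set U | soft_sw_open U /\ U [<=] F].

Lemma soft_int_largest F :
  [/\ soft_open T (soft_int F), soft_int F [<=] F &
      forall U, soft_open T U -> U [<=] F -> U [<=] soft_int F].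
Proof.
split.
- by apply: soft_open_bigcup => U [].
- by move=> e x [U [_ UF] Ux]; exact: UF.
- by move=> U oU UF e x Ux; exists U.
Qed.

Lemma soft_cl_smallest F :
  [/\ soft_closed (soft_cl F), F [<=] soft_cl F &
      forall C, soft_closed C -> F [<=] C -> soft_cl F [<=] C].
Proof.
split.
- rewrite /soft_closed.
  have -> : soft_setC (soft_cl F) =
      soft_bigcup (@soft_setC X E @` [set C | soft_closed C /\ F [<=] C]).
    apply/funext => e.
    by rewrite /soft_setC /soft_cl /soft_bigcap setC_bigcap /soft_bigcup
               bigcup_image.
  by apply: soft_open_bigcup => _ [C [cC _] <-].
- by move=> e x Fx C [_ FC]; exact: FC.
- by move=> C cC FC e x; apply.
Qed.

End SoftTopology.

Record soft_fun (X E Y E' : Type) := SoftFun {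
  soft_fun_pt : X -> Y;
  soft_fun_par : E -> E'
}.

Section SoftFunctions.
Variables X E Y E' : Type.

Definition soft_image (f : soft_fun X E Y E') (F : soft_set X E) :
    soft_set Y E' :=
  fun e' => \bigcup_(e in soft_fun_par f @^-1` [set e']) (soft_fun_pt f @` F e).

Definition soft_preimage (f : soft_fun X E Y E') (G : soft_set Y E') :
    soft_set X E :=
  fun e => soft_fun_pt f @^-1` G (soft_fun_par f e).

Definition soft_sw_open_fun (T : soft_topology X E) (S : soft_topology Y E')
    (f : soft_fun X E Y E') :=
  forall U, soft_open T U -> soft_sw_open S (soft_image f U).

End SoftFunctions.

(* Main.v *)
Require Import Defs.
From mathcomp Require Import all_boot.
From mathcomp Require Import boolp classical_sets.

Set Implicit Arguments.
Unset Strict Implicit.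
Unset Printing Implicit Defensive.

Local Open Scope classical_set_scope.

(** A soft set that contains a non-null soft sw-open set has non-null interior,
    so arbitrary unions of soft sw-open sets are soft sw-open.  Hence
    [soft_sw_int S F] is the largest soft sw-open set inside [F]
    ([soft_sw_open_int]), and [f] is soft sw-open exactly when [f(U)] is
    included in [Int_sw (f(U))] for each soft open [U].  This is the interior
    condition restricted to soft open sets, and it implies the condition for
    all [G] because the image is monotone.

    The closure condition is its dual: [Cl_sw] of a complement is the
    complement of [Int_sw] ([soft_sw_clC]), preimage commutes with complement,
    and image is left adjoint to preimage ([soft_image_preimage]).  Applied to
    the complement of [f(U)] with [U] soft open, it says that [U] lies in the
    preimage of [Int_sw (f(U))]. *)

Section SoftSetLemmas.
Variables X E : Type.
Implicit Types F G : soft_set X E.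

Lemma soft_setCK F : soft_setC (soft_setC F) = F.
Proof. by apply/funext => e; rewrite /soft_setC setCK. Qed.

Lemma soft_setCS F G : F [<=] G -> soft_setC G [<=] soft_setC F.
Proof. by move=> FG e; apply: subsetC; exact: FG. Qed.

Lemma soft_subset_refl F : F [<=] F.
Proof. by move=> e x. Qed.

Lemma soft_subset_trans F G H : F [<=] G -> G [<=] H -> F [<=] H.
Proof. by move=> FG GH e x /FG /GH. Qed.

Lemma soft_subset_anti F G : F [<=] G -> G [<=] F -> F = G.
Proof. by move=> FG GF; apply/funext => e; apply/seteqP; split. Qed.

Lemma soft_subset_null F : F [<=] soft_null -> F = soft_null.
Proof. by move=> F0; apply: soft_subset_anti => // e x. Qed.

End SoftSetLemmas.

Section SwOperators.
Variables (X E : Type) (T : soft_topology X E).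
Implicit Types F G : soft_set X E.

Lemma soft_int_mono F G : F [<=] G -> soft_int T F [<=] soft_int T G.
Proof.
move=> FG e x [U [oU UF] Ux].
by exists U => //; split=> //; exact: soft_subset_trans FG.
Qed.

Lemma soft_sw_open_subset_int F G :
  soft_sw_open T F -> F [<=] G -> F [<=] soft_sw_int T G.
Proof. by move=> oF FG e x Fx; exists F. Qed.

Lemma soft_sw_int_subset F : soft_sw_int T F [<=] F.
Proof. by move=> e x [U [_ UF] Ux]; exact: UF. Qed.

Lemma soft_sw_open_int F : soft_sw_open T (soft_sw_int T F).
Proof.
have [->|F0] := pselect (soft_sw_int T F = soft_null); first by left.
right => iF0; apply: F0; apply: soft_subset_null => e x [U [oU UF] Ux].
case: (oU) => [U0|iU]; first by rewrite -U0.
exfalso; apply/iU/soft_subset_null; rewrite -iF0.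
exact/soft_int_mono/soft_sw_open_subset_int.
Qed.

Lemma soft_sw_clC F : soft_sw_cl T (soft_setC F) = soft_setC (soft_sw_int T F).
Proof.
apply: soft_subset_anti => e x.
- move=> clx [U [oU UF] Ux].
  apply: (clx (soft_setC U)) Ux; split; last exact: soft_setCS.
  by rewrite /soft_sw_closed soft_setCK.
- move=> intx C [cC FC]; apply: contrapT => Cx; apply: intx.
  exists (soft_setC C) => //; split=> //.
  by rewrite -(soft_setCK F); exact: soft_setCS.
Qed.

End SwOperators.

Section SoftImage.
Variables (X E Y E' : Type) (f : soft_fun X E Y E').

Lemma soft_image_preimage (F : soft_set X E) (G : soft_set Y E') :
  soft_image f F [<=] G <-> F [<=] soft_preimage f G.
Proof.
split=> FG.
- by move=> e x Fx; apply: FG; exists e => //; exists x.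
- by move=> _ _ [e <- [x Fx <-]]; exact: FG.
Qed.

Lemma soft_image_mono (F G : soft_set X E) :
  F [<=] G -> soft_image f F [<=] soft_image f G.
Proof.
move=> FG; apply/soft_image_preimage/(soft_subset_trans FG).
apply/soft_image_preimage; exact: soft_subset_refl.
Qed.

Lemma soft_preimageC (G : soft_set Y E') :
  soft_preimage f (soft_setC G) = soft_setC (soft_preimage f G).
Proof. by []. Qed.

End SoftImage.

Theorem proposition5p2 (X E Y E' : Type)
    (T : soft_topology X E) (S : soft_topology Y E') (f : soft_fun X E Y E') :
  [<-> soft_sw_open_fun T S f;
       forall G : soft_set X E,
         soft_image f (soft_int T G) [<=] soft_sw_int S (soft_image f G);
       forall H : soft_set Y E',
         soft_preimage f (soft_sw_cl S H) [<=] soft_cl T (soft_preimage f H)].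
Proof.
tfae.
- move=> fo G; have [oG GG _] := soft_int_largest T G.
  by apply: soft_sw_open_subset_int; [exact: fo | exact: soft_image_mono].
- move=> f_int H.
  have [clo Hcl _] := soft_cl_smallest T (soft_preimage f H).
  set U := soft_setC (soft_cl T (soft_preimage f H)).
  have UU : U [<=] soft_int T U.
    by have [_ _ int_max] := soft_int_largest T U;
      apply: int_max => //; exact: soft_subset_refl.
  (* U avoids the preimage of H, so f(U) avoids H. *)
  have fUH : soft_image f U [<=] soft_setC H.
    by apply/soft_image_preimage; rewrite soft_preimageC; exact: soft_setCS.
  rewrite -(soft_setCK H) soft_sw_clC soft_preimageC soft_setCK.
  rewrite -(soft_setCK (soft_cl T _)); apply/soft_setCS/soft_image_preimage.
  apply: soft_subset_trans (soft_image_mono UU) _.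
  apply: soft_subset_trans (f_int U) _.
  apply: soft_sw_open_subset_int; first exact: soft_sw_open_int.
  exact: soft_subset_trans (@soft_sw_int_subset _ _ S _) fUH.
- move=> f_cl U oU.
  suff -> : soft_image f U = soft_sw_int S (soft_image f U).
    exact: soft_sw_open_int.
  apply: soft_subset_anti; last exact: soft_sw_int_subset.
  apply/soft_image_preimage; rewrite -(soft_setCK U).
  rewrite -(soft_setCK (soft_preimage _ _)).
  apply: soft_setCS; rewrite soft_setCK -soft_preimageC -soft_sw_clC.
  apply: soft_subset_trans (f_cl _) _.
  have [_ _ cl_min] :=
    soft_cl_smallest T (soft_preimage f (soft_setC (soft_image f U))).
  apply: cl_min; first by rewrite /soft_closed soft_setCK.
  rewrite soft_preimageC.
  apply/soft_setCS/soft_image_preimage; exact: soft_subset_refl.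
Qed.
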